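(* In the finite-state regularized setting of the context, suppose that (1) $\varepsilon\in(0,1)$ satisfies $\frac{\sqrt{\hat K}}{\sqrt{\hat K}+\sqrt{\hat K-\bar K}}>\beta^{1-\varepsilon}$; (2) $\sqrt{\hat K\beta}+\sqrt{(\hat K-\bar K)\beta}<1$; (3) $\frac{\bar LK_1}{\rho(1-\beta)}+\bar K<1$. Let $(\pi,\mu)$ be the mean-field equilibrium of the regularized stationary game, with corresponding $Q$-function $Q$, and for each $T$ let $(\pi^T_t,\mu^T_t)_{t=0}^{T-1}$ be a mean-field equilibrium of the regularized $T$-horizon game with initial measure $\mu_0$, with corresponding $Q$-functions $(Q^T_t)_{t=0}^{T-1}$. Then for all sufficiently large $T$ and all natural numbers $t<s<T$, $$\|\mu-\mu^T_t\|_{\mathrm{TV}}\le O\left(\left(\frac{\bar LK_1}{\rho(1-\beta)}+\bar K\right)^{t}+\frac{1}{T-t}\left(\sqrt{\frac{\hat K}{\rho(A_T)\beta}}\right)^{t}(T+1)\beta^{T\varepsilon}\right)$$ and $$\|Q-Q^T_t\|_\infty\le O\left(\frac{s-t}{T+1-t}\left(\sqrt{\frac{\hat K}{\rho(A_T)\beta}}\right)^{s}(2T+1)\beta^{(T+1)\varepsilon}+\beta^{s-t}+\left(\frac{\bar LK_1}{\rho(1-\beta)}+\bar K\right)^{t}\right),$$ where the constants implied by $O(\cdot)$ and the threshold for $T$ do not depend on $t,s,T$.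
   Context: $X$ and $A$ are finite sets; $\mathcal P(\cdot)$ denotes the set of probability measures; $\|\mu-\nu\|_{\mathrm{TV}}=\frac12\sum_{x}|\mu(x)-\nu(x)|$. Fix $\beta\in(0,1)$, $\mu_0\in\mathcal P(X)$, $c:X\times A\times\mathcal P(X)\to\mathbb R$ and $p:X\times A\times\mathcal P(X)\to\mathcal P(X)$ such that, with constants $L_1,K_1>0$, $\beta K_1<2$, for all $x,\hat x,a,\hat a,\mu,\hat\mu$: $|c(x,a,\mu)-c(\hat x,\hat a,\hat\mu)|\le L_1(1_{\{x\ne\hat x\}}+2\cdot1_{\{a\neq\hat a\}}+2\|\mu-\hat\mu\|_{\mathrm{TV}})$ and $\|p(\cdot|x,a,\mu)-p(\cdot|\hat x,\hat a,\hat\mu)\|_{\mathrm{TV}}\le\frac{K_1}{2}(1_{\{x\ne\hat x\}}+2\cdot 1_{\{a\neq\hat a\}}+2\|\mu-\hat\mu\|_{\mathrm{TV}})$. For $u\in\mathcal P(A)$ put $C(x,u,\mu)=\sum_a c(x,a,\mu)u(a)$, $P(\cdot|x,u,\mu)=\sum_a p(\cdot|x,a,\mu)u(a)$. The regularizer $\Omega:\mathcal P(A)\to\mathbb R$ is continuous and $\rho$-strongly convex with respect to $\|\cdot\|_1$, $\rho>0$: $\Omega(su+(1-s)v)\le s\Omega(u)+(1-s)\Omega(v)-\frac{\rho}{2}s(1-s)\|u-v\|_1^2$. Constants: $\bar L=\frac{L_1}{1-\beta K_1/2}$, $\bar K=\frac{3K_1}{2}+\frac{K_1\bar L}{2\rho(1-\beta)}$,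 $\hat K=\bar K+\frac{K_1\bar L}{\rho}$. For $T\ge2$, $A_T=(a_{ij})_{i,j=1}^{T-1}$ has $a_{ij}=\frac{\bar LK_1}{\rho}\beta^{\,j-i+1}$ for $j\ge i$, $a_{i,i-1}=\hat K$, $a_{ij}=0$ for $j<i-1$; $\rho(A_T)$ is its spectral radius ($\rho$ alone is the strong convexity constant). Finite horizon: for a flow $(\mu_t)_{t=0}^{T-1}$ the corresponding $Q$-functions on $X\times\mathcal P(A)$ are $Q_{T-1}(x,u)=C(x,u,\mu_{T-1})+\Omega(u)$ and $Q_t(x,u)=C(x,u,\mu_t)+\Omega(u)+\beta\sum_y\min_{b\in\mathcal P(A)}Q_{t+1}(y,b)P(y|x,u,\mu_t)$ for $t\le T-2$; each $Q_t(x,\cdot)$ has a unique minimizer $f_t(x)$. A mean-field equilibrium of the $T$-horizon game with initial measure $\mu_0$ is a pair of flows, with first state measure $\mu_0$, such that $\pi_t(\cdot|x)=\delta_{f_t(x)}$ for all $t,x$ and $\mu_{t+1}=\sum_xP(\cdot|x,f_t(x),\mu_t)\mu_t(x)$ for $0\le t\le T-2$. Stationary: for $\mu\in\mathcal P(X)$ the corresponding $Q$ is the unique bounded solution of $Q(x,u)=C(x,u,\mu)+\Omega(u)+\beta\sum_y\min_bQ(y,b)P(y|x,u,\mu)$, with unique minimizers $f(x)$; $(\pi,\mu)$ is a stationary mean-field equilibrium if $\pi(\cdot|x)=\delta_{f(x)}$ for all $x$ and $\mu=\sum_xP(\cdot|x,f(x),\mu)\mu(x)$ (it exists and is unique under (3)).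 *)

(* Defs.v *)
From HB Require Import structures.
From mathcomp Require Export all_boot all_order all_algebra.
From mathcomp Require Export all_classical all_reals all_analysis.
From mathcomp Require Export complex.

Set Implicit Arguments.
Unset Strict Implicit.
Unset Printing Implicit Defensive.

Import Order.TTheory GRing.Theory Num.Theory.
Import numFieldNormedType.Exports.

Local Open Scope classical_set_scope.
Local Open Scope ring_scope.

(* Measurable types are pointed in the library, so the Borel space of the
   simplex over a finite set requires that set to come with a point. *)
#[short(type="pointedFinType")]
HB.structure Definition PointedFinite := {T of Finite T & isPointed T}.

Section FiniteDistributions.
Context (R : realType) (T : finType).

Record fdist := FDist {
  fdist_pmf :> {ffun T -> R};
  _ : [forall x, 0 <= fdist_pmf x] && (\sum_x fdist_pmf x == 1) }.

HB.instance Definition _ := [isSub for fdist_pmf].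
HB.instance Definition _ := [Choice of fdist by <:].

Lemma fdist_ge0 (u : fdist) x : 0 <= u x.
Proof. by case: u => f /= /andP[/forallP]. Qed.

Lemma fdist_sum1 (u : fdist) : \sum_x u x = 1.
Proof. by case: u => f /= /andP[_ /eqP]. Qed.

(* The topology of pointwise convergence, which for finite T is that of the
   l1 norm. *)
HB.instance Definition _ := Topological.copy fdist
  (initial_topology (fun u : fdist => (u : T -> R) : {ptws T -> R})).

Section Mixture.
Context (s : {i01 R}) (u v : fdist).

Let mix : {ffun T -> R} := [ffun x => s%:num * u x + (1 - s%:num) * v x].

Let mix_subproof : [forall x, 0 <= mix x] && (\sum_x mix x == 1).
Proof.
apply/andP; split.
  by apply/forallP => x; rewrite ffunE addr_ge0// mulr_ge0// ?fdist_ge0 ?subr_ge0.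
under eq_bigr do rewrite ffunE.
by rewrite big_split/= -!mulr_sumr !fdist_sum1 !mulr1 addrC subrK.
Qed.

Definition fdist_mix : fdist := FDist mix_subproof.

End Mixture.

Definition l1_dist (u v : fdist) : R := \sum_x `|u x - v x|.

Definition tv_dist (u v : fdist) : R := 2^-1 * l1_dist u v.

End FiniteDistributions.

Section PointedSimplex.
Context (R : realType) (A : pointedFinType).

Let dirac_pmf : {ffun A -> R} := [ffun a => (a == point)%:R].

Let dirac_pmf_subproof :
  [forall x, 0 <= dirac_pmf x] && (\sum_x dirac_pmf x == 1).
Proof.
apply/andP; split; first by apply/forallP => x; rewrite ffunE.
rewrite (bigD1 point)//= ffunE eqxx big1 ?addr0// => x /negPf xp.
by rewrite ffunE xp.
Qed.

HB.instance Definition _ := isPointed.Build (fdist R A) (FDist dirac_pmf_subproof).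

Definition borel_simplex := g_sigma_algebraType (@open (fdist R A)).

HB.instance Definition _ := Measurable.on borel_simplex.

End PointedSimplex.

Definition strongly_convex (R : realType) (A : finType) (rho : R)
    (Omega : fdist R A -> R) :=
  forall (s : {i01 R}) (u v : fdist R A),
    Omega (fdist_mix s u v) <=
      s%:num * Omega u + (1 - s%:num) * Omega v
      - rho / 2 * s%:num * (1 - s%:num) * l1_dist u v ^+ 2.

Definition spectral_radius (R : realType) (n : nat) (M : 'M[R]_n) : R :=
  sup [set Normc.normc z | z in
    [set z : R[i] | eigenvalue (map_mx (real_complex R) M) z]].

Section Constants.
Context (R : realType) (beta L1 K1 rho : R).

Definition Lbar : R := L1 / (1 - beta * K1 / 2).

Definition Kbar : R := 3 * K1 / 2 + K1 * Lbar / (2 * rho * (1 - beta)).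

Definition Khat : R := Kbar + K1 * Lbar / rho.

Definition contraction_rate : R := Lbar * K1 / (rho * (1 - beta)) + Kbar.

(* Rows and columns are numbered from 0 instead of 1; the entries depend only
   on the difference of the indices. *)
Definition horizon_matrix (T : nat) : 'M[R]_(T.-1) :=
  \matrix_(i, j)
    if (i <= j)%N then Lbar * K1 / rho * beta ^+ (j - i).+1
    else if i == j.+1 :> nat then Khat
    else 0.

Definition horizon_rate (T : nat) : R :=
  Num.sqrt (Khat / (spectral_radius (horizon_matrix T) * beta)).

End Constants.

Section Game.
Context (R : realType) (X : finType) (A : pointedFinType).
Context (beta : R) (c : X -> A -> fdist R X -> R)
        (p : X -> A -> fdist R X -> fdist R X) (Omega : fdist R A -> R).

Definition model_dist (x x' : X) (a a' : A) (mu mu' : fdist R X) : R :=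
  (x != x')%:R + 2 * (a != a')%:R + 2 * tv_dist mu mu'.

Definition lipschitz_cost (L1 : R) := forall x x' a a' mu mu',
  `|c x a mu - c x' a' mu'| <= L1 * model_dist x x' a a' mu mu'.

Definition lipschitz_transition (K1 : R) := forall x x' a a' mu mu',
  tv_dist (p x a mu) (p x' a' mu') <= K1 / 2 * model_dist x x' a a' mu mu'.

Definition mean_cost (x : X) (u : fdist R A) (mu : fdist R X) : R :=
  \sum_a c x a mu * u a.

Definition mean_transition (x : X) (u : fdist R A) (mu : fdist R X) (y : X) : R :=
  \sum_a p x a mu y * u a.

Definition next_state_law (f : X -> fdist R A) (mu : fdist R X) (y : X) : R :=
  \sum_x mean_transition x (f x) mu y * mu x.

(* The infimum is the minimum over the compact simplex. *)
Definition bellman (mu : fdist R X) (Q : X -> fdist R A -> R) (x : X)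
    (u : fdist R A) : R :=
  mean_cost x u mu + Omega u
  + beta * \sum_y inf (range (Q y)) * mean_transition x u mu y.

Definition is_minimizer (q : fdist R A -> R) (u : fdist R A) :=
  forall v, q u <= q v.

(* The policy measure and the Dirac measure at u are compared on Borel sets
   only: outside of them, the values of a library measure are irrelevant. *)
Definition is_dirac (m : probability (borel_simplex R A) R) (u : fdist R A) :=
  forall B : set (borel_simplex R A), measurable B ->
    m B = dirac (u : borel_simplex R A) B.

(* Flows are indexed by nat; only the times t < T are constrained. *)
Definition finite_horizon_Q (T : nat) (mu : nat -> fdist R X)
    (Q : nat -> X -> fdist R A -> R) :=
  (forall t x u, t.+1 = T -> Q t x u = mean_cost x u (mu t) + Omega u) /\
  (forall t x u, (t.+1 < T)%N -> Q t x u = bellman (mu t) (Q t.+1) x u).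

Definition finite_horizon_mfe (mu0 : fdist R X) (T : nat)
    (pi : nat -> X -> probability (borel_simplex R A) R)
    (mu : nat -> fdist R X) (Q : nat -> X -> fdist R A -> R) :=
  [/\ mu 0%N = mu0,
      finite_horizon_Q T mu Q &
      exists f : nat -> X -> fdist R A,
        [/\ forall t x, (t < T)%N -> is_minimizer (Q t x) (f t x),
            forall t x, (t < T)%N -> is_dirac (pi t x) (f t x) &
            forall t y, (t.+1 < T)%N ->
              mu t.+1 y = next_state_law (f t) (mu t) y]].

Definition stationary_Q (mu : fdist R X) (Q : X -> fdist R A -> R) :=
  (exists M : R, forall x u, `|Q x u| <= M) /\
  (forall x u, Q x u = bellman mu Q x u).

Definition stationary_mfe (pi : X -> probability (borel_simplex R A) R)
    (mu : fdist R X) (Q : X -> fdist R A -> R) :=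
  stationary_Q mu Q /\
  exists f : X -> fdist R A,
    [/\ forall x, is_minimizer (Q x) (f x),
        forall x, is_dirac (pi x) (f x) &
        forall y, mu y = next_state_law f mu y].

(* Extended-real valued, so that unbounded differences have distance +oo. *)
Definition sup_dist (Q Q' : X -> fdist R A -> R) : \bar R :=
  ereal_sup (range (fun z : X * fdist R A => `|Q z.1 z.2 - Q' z.1 z.2|%:E)).

End Game.

(* Main.v *)
(* Write e_t for the total variation distance between mu and muT_t, and
   k = Lbar K1 / rho = Khat - Kbar. Strong convexity makes the minimizers
   Lipschitz in the linear part of the cost; unrolling the Bellman recursion up
   to the horizon, where the value is 0, gives
     e_(t+1) <= Kbar e_t + k sum_(t <= j < T) beta^(j-t) e_j + C beta^(T-t).
   Since Kbar + k / (1 - beta) < 1, a maximum principle compares e with any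
   supersolution. The powers r^t of the contraction rate absorb the initial
   error. The powers x^(t-T) of the minimizer x of Khat / x + k beta / (1 - beta x)
   absorb the terminal forcing: (2) says that the minimum is less than 1, and (1)
   that x > beta^(-eps). By a Collatz-Wielandt bound with weights x^j, that
   minimum dominates the spectral radius of every A_T, i.e. the horizon rate is
   at least x; no asymptotics of the spectral radius are needed. *)
Require Import Defs.
From mathcomp Require Import ring lra.
Set Implicit Arguments.
Unset Strict Implicit.
Unset Printing Implicit Defensive.

Import Order.TTheory GRing.Theory Num.Theory.
Import numFieldNormedType.Exports.

Local Open Scope classical_set_scope.
Local Open Scope ring_scope.

(** * Total variation and averages over finite distributions *)

Section Distributions.
Context (R : realType).

Lemma l1_dist_ge0 (I : finType) (u v : fdist R I) : 0 <= l1_dist u v.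
Proof. exact: sumr_ge0. Qed.

Lemma tv_dist_ge0 (I : finType) (u v : fdist R I) : 0 <= tv_dist u v.
Proof. by rewrite mulr_ge0 ?l1_dist_ge0 ?invr_ge0. Qed.

Lemma l1_distE (I : finType) (u v : fdist R I) : l1_dist u v = 2 * tv_dist u v.
Proof. by rewrite /tv_dist mulrA divff ?mul1r ?pnatr_eq0. Qed.

Lemma l1_distC (I : finType) (u v : fdist R I) : l1_dist u v = l1_dist v u.
Proof. by apply: eq_bigr => i _; rewrite distrC. Qed.

Lemma tv_distxx (I : finType) (u : fdist R I) : tv_dist u u = 0.
Proof. by rewrite /tv_dist /l1_dist big1 ?mulr0// => i _; rewrite subrr normr0. Qed.

Lemma tv_dist_le1 (I : finType) (u v : fdist R I) : tv_dist u v <= 1.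
Proof.
suff : l1_dist u v <= 2 by rewrite l1_distE; lra.
have -> : 2 = \sum_i (u i + v i) :> R by rewrite big_split/= !fdist_sum1.
apply: ler_sum => i _; apply: le_trans (ler_normB _ _) _.
by rewrite !ger0_norm ?fdist_ge0.
Qed.

Lemma fdist_inhabited (I : finType) (u : fdist R I) : exists i : I, true.
Proof.
case: (pickP (fun _ : I => true)) => [i _|I0]; first by exists i.
by have := fdist_sum1 u; rewrite big_pred0// => /eqP; rewrite eq_sym oner_eq0.
Qed.

(* The pairing only sees phi up to an additive constant; centring phi at the
   midpoint of its range gives the total variation instead of the l1 norm. *)
Lemma fdist_pairing_diff (I : finType) (phi : I -> R) (D : R)
    (u v : fdist R I) :
  (forall i j, phi i - phi j <= D) ->
  `|\sum_i phi i * u i - \sum_i phi i * v i| <= D * tv_dist u v.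
Proof.
move=> phiD; have [i0 _] := fdist_inhabited u.
case: (@arg_maxP _ _ _ i0 xpredT phi isT) => m _ mmax.
set e := phi m - D / 2.
have -> : \sum_i phi i * u i - \sum_i phi i * v i
          = \sum_i (phi i - e) * (u i - v i).
  transitivity (\sum_i phi i * u i - \sum_i phi i * v i
                - e * (\sum_i u i - \sum_i v i)).
    by rewrite !fdist_sum1 subrr mulr0 subr0.
  by rewrite -!sumrB mulr_sumr -sumrB; apply: eq_bigr => i _; ring.
apply: le_trans (ler_norm_sum _ _ _) _.
rewrite /tv_dist mulrA mulr_sumr; apply: ler_sum => i _.
rewrite normrM ler_wpM2r// ler_norml /e.
have phi_le : phi i <= phi m := mmax i isT.
by have := phiD m i => ?; apply/andP; split; lra.
Qed.

(* Testing against the signs of the coordinates reduces to the scalar case. *)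
Lemma fdist_kernel_diff (I J : finType) (F : I -> J -> R) (D : R)
    (u v : fdist R I) :
  (forall i i', \sum_j `|F i j - F i' j| <= D) ->
  \sum_j `|\sum_i F i j * u i - \sum_i F i j * v i| <= D * tv_dist u v.
Proof.
move=> FD; pose z j := \sum_i F i j * u i - \sum_i F i j * v i.
pose phi i := \sum_j Num.sg (z j) * F i j.
have -> : \sum_j `|z j| = \sum_i phi i * u i - \sum_i phi i * v i.
  have expand (w : fdist R I) :
      \sum_i phi i * w i = \sum_j Num.sg (z j) * \sum_i F i j * w i.
    under eq_bigr do rewrite mulr_suml.
    rewrite exchange_big; apply: eq_bigr => j _.
    by rewrite mulr_sumr; apply: eq_bigr => i _; rewrite mulrA.
  rewrite !expand -sumrB; apply: eq_bigr => j _.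
  by rewrite -mulrBr -/(z j) normrEsg.
apply: le_trans (ler_norm _) _; apply: fdist_pairing_diff => i i'.
apply: le_trans (FD i i'); rewrite -sumrB; apply: ler_sum => j _.
rewrite -mulrBr; apply: le_trans (ler_norm _) _; rewrite normrM.
by rewrite ler_piMl// normr_sg; case: (_ != _).
Qed.

Lemma fdist_average_dist (I J : finType) (F F' : I -> J -> R) (B : R)
    (u : fdist R I) :
  (forall i, \sum_j `|F i j - F' i j| <= B) ->
  \sum_j `|\sum_i F i j * u i - \sum_i F' i j * u i| <= B.
Proof.
move=> FB; apply: (@le_trans _ _ (\sum_i (\sum_j `|F i j - F' i j|) * u i)).
  under [leRHS]eq_bigr do rewrite mulr_suml.
  rewrite exchange_big; apply: ler_sum => j _.
  rewrite -sumrB; apply: le_trans (ler_norm_sum _ _ _) _.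
  by apply: ler_sum => i _; rewrite -mulrBl normrM (ger0_norm (fdist_ge0 u i)).
apply: (@le_trans _ _ (\sum_i B * u i)).
  by apply: ler_sum => i _; rewrite ler_wpM2r ?fdist_ge0.
by rewrite -mulr_sumr fdist_sum1 mulr1.
Qed.

Lemma fdist_average_norm (I : finType) (phi : I -> R) (B : R) (u : fdist R I) :
  (forall i, `|phi i| <= B) -> `|\sum_i phi i * u i| <= B.
Proof.
move=> phiB; apply: le_trans (ler_norm_sum _ _ _) _.
apply: (@le_trans _ _ (\sum_i B * u i)).
  apply: ler_sum => i _.
  by rewrite normrM (ger0_norm (fdist_ge0 u i)) ler_wpM2r ?fdist_ge0.
by rewrite -mulr_sumr fdist_sum1 mulr1.
Qed.

End Distributions.

(** * Quadratic growth and stability of regularized minimizers *)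

Section RegularizedMinimizers.
Context (R : realType) (A : pointedFinType) (rho : R) (Omega : fdist R A -> R).
Hypotheses (rho_gt0 : 0 < rho) (Omega_sc : strongly_convex rho Omega).

Definition regularized (g : A -> R) (u : fdist R A) : R :=
  \sum_a g a * u a + Omega u.

(** Comparing [f] with the mixture of [u] and [f] of weight s bounds (1 - s) times the left side by
    the right side; then s tends to 0. *)
Lemma minimizer_growth (g : A -> R) (f u : fdist R A) :
  is_minimizer (regularized g) f ->
  rho / 2 * l1_dist u f ^+ 2 <= regularized g u - regularized g f.
Proof.
move=> fmin; set B := _ * _; set Delta := _ - _.
have [BE DE] : B = rho / 2 * l1_dist u f ^+ 2 /\
  Delta = regularized g u - regularized g f by [].
have Delta0 : 0 <= Delta by rewrite subr_ge0; exact: fmin.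
clearbody B Delta.
rewrite leNgt; apply/negP => DB; have B0 : 0 < B by exact: le_lt_trans DB.
(* This weight replaces the limit: (1 - s) B is the midpoint (B + Delta) / 2, which exceeds
   Delta. *)
pose s := (B - Delta) / (2 * B).
have s0 : 0 < s by apply: divr_gt0; lra.
have sB : s * B = (B - Delta) / 2 by rewrite /s; field; rewrite gt_eqF.
have s1 : s <= 1 by rewrite /s ler_pdivrMr ?mulr_gt0//; lra.
pose t : {i01 R} := Itv01 (ltW s0) s1.
have sc : Omega (fdist_mix t u f) <= s * Omega u + (1 - s) * Omega f
    - rho / 2 * s * (1 - s) * l1_dist u f ^+ 2 := Omega_sc t u f.
have mixE : \sum_a g a * fdist_mix t u f a
    = s * (\sum_a g a * u a) + (1 - s) * (\sum_a g a * f a).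
  rewrite !mulr_sumr -big_split/=; apply: eq_bigr => a _.
  by rewrite ffunE /=; ring.
have := fmin (fdist_mix t u f); rewrite /regularized mixE => fmix.
have BsE : rho / 2 * s * (1 - s) * l1_dist u f ^+ 2 = s * (1 - s) * B.
  by rewrite BE; ring.
have : s * (1 - s) * B <= s * Delta by rewrite DE /regularized; lra.
rewrite -mulrA ler_pM2l//; lra.
Qed.

Lemma regularizedB (g g' : A -> R) (u : fdist R A) :
  regularized g u - regularized g' u = \sum_a (g a - g' a) * u a.
Proof.
rewrite /regularized opprD addrACA subrr addr0 -sumrB.
by apply: eq_bigr => a _; rewrite mulrBl.
Qed.

Lemma regularized_diff (g g' : A -> R) (u : fdist R A) (G : R) :
  (forall a, `|g a - g' a| <= G) -> `|regularized g u - regularized g' u| <= G.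
Proof.
by move=> gG; rewrite regularizedB; exact: fdist_average_norm.
Qed.

(** Adding the growth inequalities of both problems, each tested at the other's minimizer, cancels
    [Omega] and leaves rho d^2 <= G d for the l1 distance d. *)
Lemma minimizer_lipschitz (g g' : A -> R) (f f' : fdist R A) (G : R) :
  is_minimizer (regularized g) f -> is_minimizer (regularized g') f' ->
  (forall a, `|g a - g' a| <= G) -> l1_dist f f' <= G / rho.
Proof.
move=> fmin f'min gG; have := minimizer_growth f' fmin.
have := minimizer_growth f f'min; rewrite (l1_distC f' f) => h1 h2.
have : `|\sum_a (g a - g' a) * f' a - \sum_a (g a - g' a) * f a|
       <= G * l1_dist f f'.
  rewrite -sumrB; apply: le_trans (ler_norm_sum _ _ _) _.
  rewrite mulr_sumr; apply: ler_sum => a _.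
  by rewrite -mulrBr normrM (distrC (f' a)) ler_wpM2r.
rewrite -!regularizedB => /(le_trans (ler_norm _)) h3.
have := l1_dist_ge0 f f'; rewrite le0r => /predU1P[->|d0].
  (* If d = 0, it remains to see that G is nonnegative, which any single action shows. *)
  have [a _] := fdist_inhabited f.
  by rewrite divr_ge0 ?(le_trans _ (gG a)) ?(ltW rho_gt0).
rewrite ler_pdivlMr//; rewrite -(ler_pM2r d0).
have -> : l1_dist f f' * rho * l1_dist f f' = rho * l1_dist f f' ^+ 2 by ring.
lra.
Qed.

Lemma minimum_lipschitz (g g' : A -> R) (f f' : fdist R A) (G : R) :
  is_minimizer (regularized g) f -> is_minimizer (regularized g') f' ->
  (forall a, `|g a - g' a| <= G) ->
  `|regularized g f - regularized g' f'| <= G.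
Proof.
move=> fmin f'min gG; rewrite ler_norml.
have := regularized_diff f gG; have := regularized_diff f' gG.
rewrite !ler_norml; have := fmin f'; have := f'min f.
by move=> ? ? /andP[? ?] /andP[? ?]; apply/andP; split; lra.
Qed.

End RegularizedMinimizers.

(** * Maximum principle for a recursion that looks ahead *)

Section Comparison.
Context (R : realType) (beta : R).
Hypothesis (beta_ge0 : 0 <= beta).

Lemma truncated_geometric_le (y : R) (i T : nat) :
  0 <= y -> beta * y < 1 ->
  \sum_(i <= j < T) beta ^+ (j - i) * y ^+ j <= y ^+ i / (1 - beta * y).
Proof.
move=> y0 by1; rewrite -{1}(add0n i) big_addn.
have -> : \sum_(0 <= j < T - i) beta ^+ (j + i - i) * y ^+ (j + i)
    = y ^+ i * \sum_(0 <= j < T - i) (beta * y) ^+ j.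
  rewrite mulr_sumr; apply: eq_bigr => j _.
  by rewrite addnK exprD exprMn; ring.
rewrite ler_wpM2l ?exprn_ge0//.
rewrite -[leRHS]mul1r ler_pdivlMr ?subr_gt0// mulrC big_mkord.
rewrite -[1 - _]opprB mulNr -subrX1 opprB gerBl exprn_ge0//.
by rewrite mulr_ge0.
Qed.

Context (k Kb C x : R).
Let r := k / (1 - beta) + Kb.
Let delta := x - (Kb + k / (1 - beta * x)).
Hypotheses (beta_lt1 : beta < 1) (k_ge0 : 0 <= k) (Kb_ge0 : 0 <= Kb).
Hypotheses (C_ge0 : 0 <= C) (r_lt1 : r < 1).
Hypotheses (x_gt0 : 0 < x) (betax_lt1 : beta * x < 1) (delta_gt0 : 0 < delta).

Let r_ge0 : 0 <= r.
Proof. by rewrite addr_ge0// divr_ge0// subr_ge0 ltW. Qed.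

(* A power y ^+ i is a supersolution as soon as Kb + k / (1 - beta y) <= y; the
   excess of x over this threshold absorbs the terminal forcing. *)
Lemma supersolution (M : R) (i T : nat) (w := fun i : nat =>
    M * r ^+ i + C / delta * (x ^+ i / x ^+ T)) :
  0 <= M -> (i < T)%N ->
  Kb * w i + k * (\sum_(i <= j < T) beta ^+ (j - i) * w j)
    + C * beta ^+ (T - i) <= w i.+1.
Proof.
move=> M0 iT; set c := C / delta / x ^+ T.
have c0 : 0 <= c by rewrite /c !divr_ge0 ?exprn_ge0 ?(ltW x_gt0) ?(ltW delta_gt0).
have wE j : w j = M * r ^+ j + c * x ^+ j by rewrite /w /c; ring.
have -> : \sum_(i <= j < T) beta ^+ (j - i) * w j
    = M * (\sum_(i <= j < T) beta ^+ (j - i) * r ^+ j)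
      + c * (\sum_(i <= j < T) beta ^+ (j - i) * x ^+ j).
  by rewrite !mulr_sumr -big_split; apply: eq_bigr => j _; rewrite wE/=; ring.
have br1 : beta * r < 1.
  by apply: le_lt_trans r_lt1; rewrite ler_piMl// ltW.
have rstep : Kb * r ^+ i + k * (\sum_(i <= j < T) beta ^+ (j - i) * r ^+ j)
             <= r ^+ i.+1.
  have -> : r ^+ i.+1 = Kb * r ^+ i + k * (r ^+ i / (1 - beta)).
    by rewrite exprS {1}/r; ring.
  rewrite lerD2l ler_wpM2l//.
  apply: le_trans (@truncated_geometric_le r i T r_ge0 br1) _.
  rewrite ler_wpM2l ?exprn_ge0// lef_pV2 ?posrE ?subr_gt0//.
  by rewrite lerD2l lerN2 ler_piMr// ltW.
have xstep : Kb * x ^+ i + k * (\sum_(i <= j < T) beta ^+ (j - i) * x ^+ j)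
             <= x ^+ i.+1 - delta * x ^+ i.
  have -> : x ^+ i.+1 - delta * x ^+ i
      = Kb * x ^+ i + k * (x ^+ i / (1 - beta * x)).
    by rewrite exprS /delta; ring.
  by rewrite lerD2l ler_wpM2l// truncated_geometric_le ?ltW.
have forcing : C * beta ^+ (T - i) <= c * (delta * x ^+ i).
  have -> : c * (delta * x ^+ i) = C * (x ^+ i / x ^+ T).
    by rewrite /c; field; rewrite !gt_eqF// exprn_gt0.
  rewrite ler_wpM2l// ler_pdivlMr ?exprn_gt0//.
  rewrite -{2}(subnK (ltnW iT)) exprD mulrA -exprMn ler_piMl//.
    by rewrite exprn_ge0// ltW.
  by rewrite exprn_ile1 ?mulr_ge0// ltW.
have := ler_wpM2l M0 rstep; have := ler_wpM2l c0 xstep.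
rewrite !wE; lra.
Qed.

Lemma forward_backward_comparison (e : nat -> R) (M : R) (T : nat) :
  0 <= M -> e 0%N <= M ->
  (forall i, (i.+1 < T)%N ->
    e i.+1 <= Kb * e i + k * (\sum_(i <= j < T) beta ^+ (j - i) * e j)
              + C * beta ^+ (T - i)) ->
  forall i, (i < T)%N -> e i <= M * r ^+ i + C / delta * (x ^+ i / x ^+ T).
Proof.
move=> M0 e0M step i iT; set w := fun i : nat =>
  M * r ^+ i + C / delta * (x ^+ i / x ^+ T).
rewrite -/(w i) -subr_le0.
case: (@arg_maxP _ _ _ (Ordinal iT) xpredT (fun j : 'I_T => e j - w j) isT).
case=> m mT _ mmax; have le_max j : (j < T)%N -> e j - w j <= e m - w m.
  by move=> jT; exact: (mmax (Ordinal jT) isT).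
apply: le_trans (le_max _ iT) _; rewrite leNgt; apply/negP => dm_gt0.
case: m mT {mmax} le_max dm_gt0 => [|m] mT le_max.
  (* The recursion says nothing at index 0, but there e is at most M, hence at most w. *)
  apply/negP; rewrite -leNgt subr_le0 (le_trans e0M)// /w expr0 mulr1 lerDl.
  by rewrite mulr_ge0 ?divr_ge0 ?exprn_ge0 ?(ltW x_gt0) ?(ltW delta_gt0).
set d := e m.+1 - w m.+1 => d_gt0.
suff : d <= r * d by rewrite leNgt gtr_pMl// r_lt1.
have sup : Kb * w m + k * (\sum_(m <= j < T) beta ^+ (j - m) * w j)
    + C * beta ^+ (T - m) <= w m.+1 := supersolution M0 (ltnW mT).
have dE : d = e m.+1 - w m.+1 by []; have := step m mT.
(* Bounding every e_j by w_j + d costs d times a geometric series, at most d / (1 - beta). *)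
have sumB : \sum_(m <= j < T) beta ^+ (j - m) * e j
     <= \sum_(m <= j < T) beta ^+ (j - m) * w j + d / (1 - beta).
  rewrite -lerBlDl -sumrB.
  have := truncated_geometric_le m T (@ler01 R); rewrite mulr1 => /(_ beta_lt1).
  rewrite expr1n mul1r => /(ler_wpM2l (ltW d_gt0)); apply: le_trans.
  rewrite mulr_sumr; apply: ler_sum_nat => j /andP[_ jT].
  by rewrite -mulrBr expr1n mulr1 mulrC ler_wpM2r ?exprn_ge0// le_max.
have := ler_wpM2l k_ge0 sumB; have := ler_wpM2l Kb_ge0 (le_max m (ltnW mT)).
rewrite -/d => h1 h2 h3.
have -> : r * d = Kb * d + k * (d / (1 - beta)) by rewrite /r; ring.
by clearbody w d; rewrite [leLHS]dE; lra.
Qed.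

End Comparison.

(** * Spectral radius of nonnegative matrices *)

Section SpectralRadius.
Context (R : realType).

(** Collatz-Wielandt: the moduli of a left eigenvector, paired with [w], have a positive total S
    with |z| S <= B S. *)
Lemma eigenvalue_normc_le (n : nat) (M : 'M[R]_n) (w : 'I_n -> R) (B : R)
    (z : R[i]) :
  (forall i j, 0 <= M i j) -> (forall i, 0 < w i) ->
  (forall i, \sum_j M i j * w j <= B * w i) ->
  eigenvalue (map_mx (real_complex R) M) z -> Normc.normc z <= B.
Proof.
move=> M0 w0 Mw /eigenvalueP[v vM vn0].
pose nv j := Normc.normc (v 0 j).
have nv_ge0 j : 0 <= nv j by rewrite /nv; case: (v 0 j) => a b; exact: sqrtr_ge0.
have nv_step j : Normc.normc z * nv j <= \sum_i nv i * M i j.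
  rewrite /nv -Normc.normcM.
  have -> : z * v 0 j = \sum_i v 0 i * (M i j)%:C%C.
    have /matrixP/(_ 0 j) := vM; rewrite !mxE => <-.
    by apply: eq_bigr => i _; rewrite mxE.
  elim/big_ind2: _ => [|x a y b xa yb|i _].
  - by rewrite Normc.normc0.
  - by apply: le_trans (le_normcD _ _) _; exact: lerD.
  - by rewrite Normc.normcM /= expr0n addr0 sqrtr_sqr (ger0_norm (M0 i j)).
have S_gt0 : 0 < \sum_j nv j * w j.
  rewrite lt_def sumr_ge0 ?andbT; last by move=> i _; rewrite mulr_ge0 ?(ltW (w0 i)).
  apply: contra vn0 => /eqP S0; apply/eqP/rowP => j; rewrite mxE.
  apply: Normc.eq0_normc; apply/eqP; rewrite -/(nv j).
  have /psumr_eq0P/(_ S0 j isT)/eqP : forall i, true -> 0 <= nv i * w i.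
    by move=> i _; rewrite mulr_ge0 ?(ltW (w0 i)).
  by rewrite mulf_eq0 (gt_eqF (w0 j)) orbF.
rewrite -(ler_pM2r S_gt0) !mulr_sumr.
apply: (@le_trans _ _ (\sum_j (\sum_i nv i * M i j) * w j)).
  by apply: ler_sum => j _; rewrite mulrA ler_wpM2r ?(ltW (w0 j)).
under eq_bigr do rewrite mulr_suml.
rewrite exchange_big/=; apply: ler_sum => i _.
under eq_bigr do rewrite -mulrA.
by rewrite -mulr_sumr mulrCA ler_wpM2l.
Qed.

(** If all eigenvalues vanished, the characteristic polynomial would be X^n; but its coefficient in
    degree n - 1 is the opposite of the trace. *)
Lemma nonzero_eigenvalue (F : closedFieldType) (n : nat) (M : 'M[F]_n) :
  \tr M != 0 -> exists2 z, eigenvalue M z & z != 0.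
Proof.
case: n M => [|n] M trM; first by move: trM; rewrite /mxtrace big_ord0 eqxx.
have [s sE] := closed_field_poly_normal (char_poly M).
move: sE; rewrite (monicP (char_poly_monic M)) scale1r => sE.
have [/hasP[z zs zn0]|] := boolP (has (fun z => z != 0) s).
  exists z => //; rewrite eigenvalue_root_char sE.
  by rewrite root_prod_XsubC.
rewrite -all_predC => /allP s0; move: trM; rewrite -oppr_eq0 -char_poly_trace//.
have -> : char_poly M = 'X^(size s).
  rewrite sE big_seq (eq_bigr (fun=> 'X)) => [|z zs].
    by rewrite -big_seq big_const_seq count_predT iter_mulr_1.
  by have := s0 z zs; rewrite /= negbK => /eqP ->; rewrite subr0.
have := size_char_poly M; rewrite sE size_prod_XsubC => -[->].
by rewrite coefXn ltn_eqF// eqxx.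
Qed.

(** Positivity matters because the radius is a divisor in [horizon_rate]. The nonzero trace provides
    a nonzero eigenvalue, which also makes the set under the supremum nonempty. *)
Lemma spectral_radius_bounds (n : nat) (M : 'M[R]_n) (w : 'I_n -> R) (B : R) :
  (forall i j, 0 <= M i j) -> (forall i, 0 < w i) ->
  (forall i, \sum_j M i j * w j <= B * w i) -> \tr M != 0 ->
  0 < spectral_radius M <= B.
Proof.
move=> M0 w0 Mw trM; have ub := eigenvalue_normc_le M0 w0 Mw.
have [z zE zn0] : exists2 z, eigenvalue (map_mx (real_complex R) M) z & z != 0.
  by apply: nonzero_eigenvalue; rewrite trace_map_mx fmorph_eq0.
have z_gt0 : 0 < Normc.normc z.
  rewrite lt_def; apply/andP; split.
    by apply: contra zn0 => /eqP/Normc.eq0_normc ->.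
  by case: (z) => a b; exact: sqrtr_ge0.
apply/andP; split.
  apply: lt_le_trans z_gt0 _; apply: ub_le_sup; last by exists z.
  by exists B => _ [y yE <-]; exact: ub.
apply: ge_sup; first by exists (Normc.normc z), z.
by move=> _ [y yE <-]; exact: ub.
Qed.

End SpectralRadius.

(** * The constants and the critical rate *)

Section Rates.
Context (R : realType) (beta L1 K1 rho : R).
Hypotheses (beta_gt0 : 0 < beta) (beta_lt1 : beta < 1).
Hypotheses (L1_gt0 : 0 < L1) (K1_gt0 : 0 < K1) (rho_gt0 : 0 < rho).
Hypothesis bK1 : beta * K1 < 2.
Let Lb := Lbar beta L1 K1.
Let Kb := Kbar beta L1 K1 rho.
Let Kh := Khat beta L1 K1 rho.

Definition feedback_gain : R := Lb * K1 / rho.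
Let k := feedback_gain.

Lemma Lbar_gt0 : 0 < Lb.
Proof. by rewrite divr_gt0// subr_gt0 ltr_pdivrMr// mul1r. Qed.

(** If the value oscillates by S, the action costs vary with the state by at most L1 + beta S K1 / 2
    ([action_cost_state]); [Lbar] arises as the fixed point of this map. *)
Lemma Lbar_fixpoint : L1 + beta * Lb * K1 / 2 = Lb.
Proof. by rewrite /Lb /Lbar; field; rewrite gt_eqF// subr_gt0. Qed.

Lemma feedback_gain_gt0 : 0 < k.
Proof. exact: divr_gt0 (mulr_gt0 Lbar_gt0 K1_gt0) rho_gt0. Qed.

Lemma Kbar_gt0 : 0 < Kb.
Proof.
rewrite /Kb /Kbar; apply: addr_gt0; first by rewrite divr_gt0 ?mulr_gt0.
apply: divr_gt0; first exact: mulr_gt0 K1_gt0 Lbar_gt0.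
by rewrite !mulr_gt0 ?subr_gt0.
Qed.

Lemma KhatE : Kh = Kb + k.
Proof. by rewrite /Kh /Khat /k /feedback_gain [K1 * _]mulrC. Qed.

Lemma contraction_rateE : contraction_rate beta L1 K1 rho = k / (1 - beta) + Kb.
Proof. by rewrite /contraction_rate invfM mulrA. Qed.

(** For a policy of span Lbar / rho, [next_state_law_dist] yields the left side after halving.
    [Kbar] carries an extra factor 1 / (1 - beta) >= 1 on its second summand. *)
Lemma one_step_coefficient_le : K1 / 2 * (3 + Lb / rho) <= Kb.
Proof.
have [L0 k0] := (Lbar_gt0, feedback_gain_gt0).
have -> : Kb = 3 * K1 / 2 + k / 2 * (1 - beta)^-1.
  by rewrite /Kb /Kbar /k /feedback_gain -/Lb; field; rewrite !gt_eqF ?subr_gt0.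
have -> : K1 / 2 * (3 + Lb / rho) = 3 * K1 / 2 + k / 2.
  by rewrite /k /feedback_gain; field; rewrite gt_eqF.
rewrite lerD2l; apply: ler_peMr; first by rewrite divr_ge0 ?(ltW k0).
by rewrite invf_ge1 ?subr_gt0// gerBl ltW.
Qed.

(* The minimizer of x |-> Khat / x + k beta / (1 - beta x) on (0, 1 / beta). *)
Definition critical_rate : R :=
  Num.sqrt Kh / (beta * (Num.sqrt Kh + Num.sqrt (Kh - Kb))).
Let x := critical_rate.
Let a := Num.sqrt Kh.
Let b := Num.sqrt (Kh - Kb).

Let a_gt0 : 0 < a.
Proof. by rewrite sqrtr_gt0 KhatE addr_gt0 ?Kbar_gt0 ?feedback_gain_gt0. Qed.

Let b_gt0 : 0 < b.
Proof. by rewrite sqrtr_gt0 KhatE addrAC subrr add0r feedback_gain_gt0. Qed.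

Let a2 : a ^+ 2 = Kh.
Proof. by rewrite sqr_sqrtr// KhatE addr_ge0 ?ltW ?Kbar_gt0 ?feedback_gain_gt0. Qed.

Let b2 : b ^+ 2 = k.
Proof.
rewrite sqr_sqrtr KhatE addrAC subrr add0r// ltW//; exact: feedback_gain_gt0.
Qed.

Let ab_gt0 : 0 < a + b. Proof. exact: addr_gt0. Qed.

Lemma critical_rate_gt0 : 0 < x.
Proof. by rewrite divr_gt0 ?mulr_gt0. Qed.

Let betax : beta * x = a / (a + b).
Proof. by rewrite /x /critical_rate -/a -/b; field; rewrite !gt_eqF. Qed.

Lemma beta_critical_rate_lt1 : beta * x < 1.
Proof. by rewrite betax ltr_pdivrMr// mul1r ltrDl. Qed.

Let gain_term : k / (1 - beta * x) = b * (a + b).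
Proof. by rewrite betax -b2; field; rewrite addrAC subrr add0r !gt_eqF. Qed.

(** With a and b the square roots of Khat and Khat - Kbar, the difference factors as a (1 - (a +
    b)^2 beta) / (beta (a + b)), and the hypothesis says that (a + b) sqrt(beta) < 1. *)
Lemma critical_rate_strict :
  Num.sqrt (Kh * beta) + Num.sqrt ((Kh - Kb) * beta) < 1 ->
  0 < x - (Kb + k / (1 - beta * x)).
Proof.
have Kh0 : 0 <= Kh by rewrite -a2 sqr_ge0.
have k0 : 0 <= Kh - Kb by rewrite KhatE addrAC subrr add0r -b2 sqr_ge0.
rewrite !sqrtrM// -/a -/b -mulrDl => lt1.
have sq : (a + b) ^+ 2 * beta < 1.
  rewrite -(sqr_sqrtr (ltW beta_gt0)) -exprMn exprn_ilt1//.
  by rewrite mulr_ge0 ?sqrtr_ge0 ?ltW.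
have KbE : Kb = a ^+ 2 - b ^+ 2 by rewrite a2 b2 KhatE addrK.
rewrite gain_term KbE /x /critical_rate -/a -/b.
rewrite (_ : _ - _ = a * (1 - (a + b) ^+ 2 * beta) / (beta * (a + b))).
  by rewrite divr_gt0 ?mulr_gt0 ?subr_gt0.
by field; rewrite !gt_eqF.
Qed.

(** Since a / (a + b) = beta x, dividing the hypothesis by beta gives x > beta^(-eps). *)
Lemma critical_rate_ge (eps : R) :
  a / (a + b) > beta `^ (1 - eps) -> (x ^-1) <= beta `^ eps.
Proof.
rewrite -betax powRD ?(gt_eqF beta_gt0) ?implybT//.
rewrite powRr1 ?(ltW beta_gt0)// ltr_pM2l// powRN => lt_x.
by rewrite -[leRHS]invrK lef_pV2 ?posrE ?critical_rate_gt0 ?invr_gt0 ?powR_gt0// ltW.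
Qed.

(** With weights x^j, row i sums to at most (k beta / (1 - beta x) + Khat / x) x^i. At the critical
    x the factor equals Khat / (x^2 beta); it bounds the spectral radius, and solving for x gives
    the claim. *)
Lemma critical_rate_le_horizon_rate (T : nat) :
  (1 < T)%N -> x <= horizon_rate beta L1 K1 rho T.
Proof.
case: T => [//|[//|n]] _; set M := horizon_matrix beta L1 K1 rho n.+2.
have x0 := critical_rate_gt0; have k0 := feedback_gain_gt0.
have Kh0 : 0 < Kh by rewrite -a2 exprn_gt0.
have ME i j : M i j = if (i <= j)%N then k * beta ^+ (j - i).+1
    else if i == j.+1 :> nat then Kh else 0 by rewrite mxE.
have M0 i j : 0 <= M i j.
  rewrite ME; case: ifP => _; first by rewrite mulr_ge0 ?exprn_ge0 ?ltW.
  by case: ifP => _ //; rewrite ltW.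
have row_sum i : \sum_j M i j * x ^+ j <= Kh / (x ^+ 2 * beta) * x ^+ i.
  have -> : Kh / (x ^+ 2 * beta) * x ^+ i
      = k * beta * (x ^+ i / (1 - beta * x)) + Kh * (x ^+ i / x).
    have -> : k * beta * (x ^+ i / (1 - beta * x))
        = k / (1 - beta * x) * beta * x ^+ i by ring.
    rewrite gain_term -a2 /x /critical_rate -/a -/b.
    by field; rewrite !gt_eqF.
  apply: (@le_trans _ _
      (\sum_(j < n.+1 | (i <= j)%N) k * beta * (beta ^+ (j - i) * x ^+ j)
       + \sum_(j < n.+1 | i == j.+1 :> nat) Kh * x ^+ j)).
    rewrite [X in _ <= X + _]big_mkcond [X in _ <= _ + X]big_mkcond -big_split/=.
    apply: ler_sum => j _; rewrite ME; case: ifP => ij.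
      rewrite ltn_eqF ?ltnS// addr0 exprS.
      by rewrite le_eqVlt; apply/orP; left; apply/eqP; ring.
    by rewrite add0r; case: ifP => _; rewrite ?mul0r.
  apply: lerD.
    rewrite -mulr_sumr ler_wpM2l//; first by rewrite mulr_ge0// ltW.
    rewrite -(big_geq_mkord i n.+1 xpredT (fun j => beta ^+ (j - i) * x ^+ j)).
    by have := truncated_geometric_le (ltW beta_gt0) i n.+1 (ltW x0)
      beta_critical_rate_lt1.
  (* The first row has no subdiagonal entry; row i + 1 has exactly one, in column i. *)
  case: i => -[|i] iT /=.
    rewrite big_pred0//; apply: mulr_ge0; first exact: ltW.
    by rewrite divr_ge0 ?(ltW x0).
  rewrite (big_pred1 (Ordinal (ltnW iT))) => [|j].
    by rewrite /= exprSr mulfK// gt_eqF.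
  by rewrite /= eqSS eq_sym.
have trM : \tr M != 0.
  rewrite gt_eqF// /mxtrace (eq_bigr (fun=> k * beta)) => [|j _].
    by rewrite sumr_const card_ord pmulrn_lgt0// mulr_gt0.
  by rewrite ME leqnn subnn expr1.
have [] := andP (spectral_radius_bounds M0
  (fun i : 'I_n.+1 => exprn_gt0 i x0) row_sum trM).
rewrite /horizon_rate -/M -/Kh => S_gt0 S_le.
rewrite -[leLHS](ger0_norm (ltW x0)) -sqrtr_sqr ler_wsqrtr//.
have x2b_gt0 : 0 < x ^+ 2 * beta by apply: mulr_gt0 => //; exact: exprn_gt0.
by rewrite ler_pdivlMr ?mulr_gt0// mulrCA -ler_pdivlMr.
Qed.

End Rates.

(** * Lipschitz estimates for one stage *)

Section OneStepEstimates.
Context (R : realType) (X : finType) (A : pointedFinType).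
Context (beta L1 K1 : R) (c : X -> A -> fdist R X -> R)
        (p : X -> A -> fdist R X -> fdist R X).
Hypotheses (beta_ge0 : 0 <= beta) (L1_ge0 : 0 <= L1) (K1_ge0 : 0 <= K1).
Hypotheses (cL : lipschitz_cost c L1) (pL : lipschitz_transition p K1).
Implicit Types (mu : fdist R X) (u : fdist R A).

Definition action_cost (v : X -> R) mu (x : X) (a : A) : R :=
  c x a mu + beta * \sum_y v y * p x a mu y.

(** Apart from [Omega], the Bellman right side is linear in the control; with [action_cost] as its
    coefficients, the stability lemmas for regularized minimizers apply. *)
Lemma regularized_action_cost (Omega : fdist R A -> R) (v : X -> R) mu x u :
  mean_cost c x u mu + Omega u + beta * (\sum_y v y * mean_transition p x u mu y)
  = regularized Omega (action_cost v mu x) u.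
Proof.
rewrite /regularized addrAC; congr (_ + _).
under [RHS]eq_bigr do rewrite mulrDl.
rewrite big_split/=; congr (_ + _).
rewrite /mean_transition mulr_sumr.
under [LHS]eq_bigr do rewrite mulrA mulr_sumr.
rewrite exchange_big/=; apply: eq_bigr => a _.
by rewrite mulr_sumr mulr_suml; apply: eq_bigr => y _; ring.
Qed.

(** Only the oscillation S of v enters, by [fdist_pairing_diff]; changing the state alone makes
    [model_dist] at most 1. *)
Lemma action_cost_state (v : X -> R) (S : R) mu x x' a :
  0 <= S -> (forall y y', v y - v y' <= S) ->
  `|action_cost v mu x a - action_cost v mu x' a| <= L1 + beta * S * K1 / 2.
Proof.
move=> S0 vS; rewrite /action_cost opprD addrACA -mulrBr.
have dist1 : model_dist x x' a a mu mu <= 1.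
  by rewrite /model_dist tv_distxx eqxx !mulr0 !addr0; case: (_ != _).
apply: le_trans (ler_normD _ _) (lerD _ _).
  by apply: le_trans (cL _ _ _ _ _ _) _; rewrite ler_piMr.
rewrite normrM (ger0_norm beta_ge0) -!mulrA ler_wpM2l//.
apply: le_trans (fdist_pairing_diff _ _ vS) _; rewrite ler_wpM2l//.
by apply: le_trans (pL _ _ _ _ _ _) _; rewrite ler_piMr// divr_ge0.
Qed.

(** The continuation terms are compared through the pairing of v with the transition under mu': the
    oscillation of v controls the change of law, and D the change of value. For S = [Lbar] the first
    coefficient becomes 2 Lbar. *)
Lemma action_cost_measure (v v' : X -> R) (S D : R) mu mu' x a :
  0 <= S -> (forall y y', v y - v y' <= S) -> (forall y, `|v y - v' y| <= D) ->
  `|action_cost v mu x a - action_cost v' mu' x a|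
    <= 2 * (L1 + beta * S * K1 / 2) * tv_dist mu mu' + beta * D.
Proof.
move=> S0 vS vD; rewrite /action_cost opprD addrACA -mulrBr.
have distE : model_dist x x a a mu mu' = 2 * tv_dist mu mu'.
  by rewrite /model_dist !eqxx !mulr0 !add0r.
have -> : \sum_y v y * p x a mu y - \sum_y v' y * p x a mu' y
    = (\sum_y v y * p x a mu y - \sum_y v y * p x a mu' y)
      + \sum_y (v y - v' y) * p x a mu' y.
  rewrite -!sumrB -big_split; apply: eq_bigr => y _ /=; ring.
have cost := cL x x a a mu mu'; rewrite distE in cost.
have trans := pL x x a a mu mu'; rewrite distE in trans.
have pair := fdist_pairing_diff (p x a mu) (p x a mu') vS.
have aver := fdist_average_norm (p x a mu') vD.
apply: le_trans (ler_normD _ _) _; rewrite normrM (ger0_norm beta_ge0).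
have := ler_wpM2l beta_ge0 (le_trans (ler_normD _ _) (lerD pair aver)).
have := ler_wpM2l beta_ge0 (ler_wpM2l S0 trans); lra.
Qed.

Lemma sum_norm_triangle (I : finType) (F G H : I -> R) :
  \sum_i `|F i - H i| <= \sum_i `|F i - G i| + \sum_i `|G i - H i|.
Proof. by rewrite -big_split; apply: ler_sum => i _; exact: ler_distD. Qed.

Lemma mean_transition_state x x' u mu :
  \sum_y `|mean_transition p x u mu y - mean_transition p x' u mu y| <= K1.
Proof.
apply: fdist_average_dist => a; rewrite -/(l1_dist _ _) l1_distE.
have := pL x x' a a mu mu.
rewrite /model_dist tv_distxx eqxx !mulr0 !addr0.
by have := K1_ge0; case: (_ != _) => /=; rewrite ?mulr1 ?mulr0; lra.
Qed.

Lemma mean_transition_control x u u' mu :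
  \sum_y `|mean_transition p x u mu y - mean_transition p x u' mu y|
    <= K1 * l1_dist u u'.
Proof.
rewrite l1_distE mulrA; apply: fdist_kernel_diff => a a'.
rewrite -/(l1_dist _ _) l1_distE.
have := pL x x a a' mu mu.
rewrite /model_dist tv_distxx eqxx !mulr0 !addr0 add0r.
by have := K1_ge0; case: (_ != _) => /=; rewrite ?mulr1 ?mulr0; lra.
Qed.

Lemma mean_transition_measure x u mu mu' :
  \sum_y `|mean_transition p x u mu y - mean_transition p x u mu' y|
    <= 2 * K1 * tv_dist mu mu'.
Proof.
apply: fdist_average_dist => a; rewrite -/(l1_dist _ _) l1_distE.
have := pL x x a a mu mu'.
by rewrite /model_dist !eqxx !mulr0 !add0r; lra.
Qed.

(** Three changes in turn: the averaging measure, the policy, the measure inside the kernel. As the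
    averaging measure is changed first, the span D concerns f alone, which will be the stationary
    policy. *)
Lemma next_state_law_dist (f f' : X -> fdist R A) mu mu' (D d : R) :
  (forall x x', l1_dist (f x) (f x') <= D) ->
  (forall x, l1_dist (f x) (f' x) <= d) ->
  \sum_y `|next_state_law p f mu y - next_state_law p f' mu' y|
    <= K1 * (3 + D) * tv_dist mu mu' + K1 * d.
Proof.
move=> fD fd.
pose law g nu nu' y := \sum_x mean_transition p x (g x) nu y * nu' x.
have state : \sum_y `|law f mu mu y - law f mu mu' y|
    <= (K1 + K1 * D) * tv_dist mu mu'.
  apply: fdist_kernel_diff => x x'.
  apply: le_trans (sum_norm_triangle _
    (fun y => mean_transition p x' (f x) mu y) _) _.
  apply: lerD; first exact: mean_transition_state.
  by apply: le_trans (mean_transition_control _ _ _ _) _; rewrite ler_wpM2l.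
have control : \sum_y `|law f mu mu' y - law f' mu mu' y| <= K1 * d.
  apply: fdist_average_dist => x.
  by apply: le_trans (mean_transition_control _ _ _ _) _; rewrite ler_wpM2l.
have measure : \sum_y `|law f' mu mu' y - law f' mu' mu' y|
    <= 2 * K1 * tv_dist mu mu'.
  by apply: fdist_average_dist => x; exact: mean_transition_measure.
have tri1 := sum_norm_triangle (law f mu mu) (law f mu mu') (law f' mu' mu').
have tri2 := sum_norm_triangle (law f mu mu') (law f' mu mu') (law f' mu' mu').
by apply: le_trans tri1 _; lra.
Qed.

End OneStepEstimates.

(** * Equilibria in terms of value functions *)

Section ValueFunctions.
Context (R : realType) (X : finType) (A : pointedFinType).
Context (beta : R) (c : X -> A -> fdist R X -> R)
        (p : X -> A -> fdist R X -> fdist R X) (Omega : fdist R A -> R).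
Let q (v : X -> R) mu x := regularized Omega (action_cost beta c p v mu x).

Lemma inf_minimizer (h : fdist R A -> R) (u : fdist R A) :
  is_minimizer h u -> inf (range h) = h u.
Proof.
move=> umin; apply/eqP; rewrite eq_le; apply/andP; split.
  by apply: ge_inf; [exists (h u) => _ [w _ <-]; exact: umin | exists u].
by apply: lb_le_inf; [exists (h u), u | move=> _ [w _ <-]; exact: umin].
Qed.

Lemma bellman_minimizer (mu : fdist R X) (Q : X -> fdist R A -> R)
    (f : X -> fdist R A) x u :
  (forall y, is_minimizer (Q y) (f y)) ->
  bellman beta c p Omega mu Q x u = q (fun y => Q y (f y)) mu x u.
Proof.
move=> fmin; rewrite /q -regularized_action_cost /bellman.
by under eq_bigr do rewrite (inf_minimizer (fmin _)).
Qed.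

Lemma stationary_mfe_values pi (mu : fdist R X) (Q : X -> fdist R A -> R) :
  stationary_mfe beta c p Omega pi mu Q ->
  exists (f : X -> fdist R A) (v : X -> R),
    [/\ forall x, Q x =1 q v mu x, forall x, is_minimizer (q v mu x) (f x),
        forall x, v x = q v mu x (f x) &
        forall y, mu y = next_state_law p f mu y].
Proof.
move=> [[_ QE] [f [fmin _ muE]]]; exists f, (fun x => Q x (f x)).
have Qq x : Q x =1 q (fun x => Q x (f x)) mu x.
  by move=> u; rewrite {1}QE (bellman_minimizer _ _ _ fmin).
by split=> // x; [move=> u; rewrite -!Qq; exact: fmin | rewrite Qq].
Qed.

Lemma finite_horizon_mfe_values (mu0 : fdist R X) (T : nat) pi
    (mu : nat -> fdist R X) (Q : nat -> X -> fdist R A -> R) :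
  finite_horizon_mfe beta c p Omega mu0 T pi mu Q ->
  exists (f : nat -> X -> fdist R A) (v : nat -> X -> R),
    [/\ forall x, v T x = 0,
        forall t x, (t < T)%N -> Q t x =1 q (v t.+1) (mu t) x,
        forall t x, (t < T)%N -> is_minimizer (q (v t.+1) (mu t) x) (f t x),
        forall t x, (t < T)%N -> v t x = q (v t.+1) (mu t) x (f t x) &
        forall t y, (t.+1 < T)%N -> mu t.+1 y = next_state_law p (f t) (mu t) y].
Proof.
move=> [_ [Qlast Qstep] [f [fmin _ muE]]].
(* The value 0 from time T on lets the last stage, which has no continuation term, obey the same
   recursion as the others. *)
pose v t x := if (t < T)%N then Q t x (f t x) else 0.
have Qq t x : (t < T)%N -> Q t x =1 q (v t.+1) (mu t) x.
  move=> tT u; have [tT1|] := ltnP t.+1 T.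
    rewrite Qstep// (bellman_minimizer _ _ _ (fun y => fmin t.+1 y tT1)).
    by rewrite /v tT1.
  move=> Tt; have tTE : t.+1 = T by apply/eqP; rewrite eqn_leq tT Tt.
  rewrite Qlast// /q -regularized_action_cost big1 ?mulr0 ?addr0// => y _.
  by rewrite /v tTE ltnn mul0r.
exists f, v; split=> //.
- by move=> x; rewrite /v ltnn.
- by move=> t x tT u; rewrite -!Qq//; exact: fmin.
- by move=> t x tT; rewrite -Qq// /v tT.
Qed.

End ValueFunctions.

(** * Distance between the stationary and the finite-horizon equilibrium *)

Section HorizonGap.
Context (R : realType) (X : finType) (A : pointedFinType).
Context (beta L1 K1 rho : R) (c : X -> A -> fdist R X -> R)
        (p : X -> A -> fdist R X -> fdist R X) (Omega : fdist R A -> R).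
Hypotheses (beta_gt0 : 0 < beta) (beta_lt1 : beta < 1).
Hypotheses (L1_gt0 : 0 < L1) (K1_gt0 : 0 < K1) (rho_gt0 : 0 < rho).
Hypothesis bK1 : beta * K1 < 2.
Hypotheses (cL : lipschitz_cost c L1) (pL : lipschitz_transition p K1).
Hypothesis Omega_sc : strongly_convex rho Omega.
Let q (v : X -> R) mu x := regularized Omega (action_cost beta c p v mu x).
Let Lb := Lbar beta L1 K1.
Let Lb_gt0 : 0 < Lb. Proof. exact: Lbar_gt0. Qed.

Context (mu : fdist R X) (f : X -> fdist R A) (v : X -> R).
Hypotheses (f_min : forall x, is_minimizer (q v mu x) (f x)).
Hypotheses (vE : forall x, v x = q v mu x (f x)).
Hypotheses (muE : forall y, mu y = next_state_law p f mu y).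

(** The largest difference S of v satisfies S <= L1 + beta S K1 / 2 by the Bellman equation; as beta
    K1 < 2, this can be solved for S. *)
Lemma value_span x x' : v x - v x' <= Lb.
Proof.
have [x0 _] := fdist_inhabited mu.
case: (@arg_maxP _ _ _ (x0, x0) xpredT (fun z => v z.1 - v z.2) isT).
case=> m m' _ mmax; set S := v m - v m'.
have vS y y' : v y - v y' <= S := mmax (y, y') isT.
have S0 : 0 <= S by rewrite -(subrr (v x0)).
apply: le_trans (vS x x') _.
have : S <= L1 + beta * S * K1 / 2.
  apply: le_trans (ler_norm _) _; rewrite {1}/S (vE m) (vE m').
  apply: (minimum_lipschitz (f_min m) (f_min m')) => a.
  by apply: action_cost_state => //; exact: ltW.
have fac_gt0 : 0 < 1 - beta * K1 / 2 by rewrite subr_gt0 ltr_pdivrMr// mul1r.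
rewrite /Lb /Lbar ler_pdivlMr//; clearbody S; lra.
Qed.

Lemma policy_span x x' : l1_dist (f x) (f x') <= Lb / rho.
Proof.
apply: (minimizer_lipschitz rho_gt0 Omega_sc (f_min x) (f_min x')) => a.
have <- : L1 + beta * Lb * K1 / 2 = Lb := Lbar_fixpoint L1 bK1.
apply: action_cost_state => //; rewrite ?ltW//; exact: value_span.
Qed.

Context (V : R) (T : nat) (mut : nat -> fdist R X)
        (ft : nat -> X -> fdist R A) (vt : nat -> X -> R).
Hypothesis v_le : forall x, `|v x| <= V.
Hypothesis vtT : forall x, vt T x = 0.
Hypothesis ft_min : forall t x, (t < T)%N ->
  is_minimizer (q (vt t.+1) (mut t) x) (ft t x).
Hypothesis vtE : forall t x, (t < T)%N ->
  vt t x = q (vt t.+1) (mut t) x (ft t x).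
Hypothesis mutE : forall t y, (t.+1 < T)%N ->
  mut t.+1 y = next_state_law p (ft t) (mut t) y.

(** The solution of G_t = 2 Lbar e_t + beta G_(t+1) with G_T = V, where e_t is the distance of the
    flows at time t. *)
Definition horizon_gap (t : nat) : R :=
  2 * Lb * (\sum_(t <= j < T) beta ^+ (j - t) * tv_dist mu (mut j))
  + beta ^+ (T - t) * V.

Lemma horizon_gapS t : (t < T)%N ->
  horizon_gap t = 2 * Lb * tv_dist mu (mut t) + beta * horizon_gap t.+1.
Proof.
move=> tT; rewrite /horizon_gap big_ltn// subnn expr0 mul1r.
rewrite -(subnSK tT) exprS.
have -> : \sum_(t.+1 <= j < T) beta ^+ (j - t) * tv_dist mu (mut j)
    = beta * \sum_(t.+1 <= j < T) beta ^+ (j - t.+1) * tv_dist mu (mut j).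
  rewrite mulr_sumr; apply: eq_big_nat => j /andP[tj _].
  by rewrite -(subnSK tj) exprS mulrA.
by ring.
Qed.

Lemma action_cost_gap t x a : (t < T)%N ->
  (forall y, `|v y - vt t.+1 y| <= horizon_gap t.+1) ->
  `|action_cost beta c p v mu x a - action_cost beta c p (vt t.+1) (mut t) x a|
    <= horizon_gap t.
Proof.
move=> tT gapS; rewrite horizon_gapS//.
have <- : L1 + beta * Lb * K1 / 2 = Lb := Lbar_fixpoint L1 bK1.
by apply: action_cost_measure => //; rewrite ?ltW//; exact: value_span.
Qed.

(** Backward induction from T, where [vt] vanishes and the gap is V. *)
Lemma value_gap t x : (t <= T)%N -> `|v x - vt t x| <= horizon_gap t.
Proof.
move=> /subnK; move: (T - t)%N => n; elim: n t x => [|n IH] t x nT.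
  rewrite add0n in nT; rewrite nT /horizon_gap vtT subr0.
  by rewrite big_geq// subnn expr0 mulr0 add0r mul1r.
have tT : (t < T)%N by rewrite -nT ltnS leq_addl.
rewrite vE vtE//; apply: (minimum_lipschitz (f_min x) (ft_min x tT)) => a.
by apply: action_cost_gap => // y; apply: IH; rewrite addnS -nT.
Qed.

Lemma action_cost_horizon_gap t x a : (t < T)%N ->
  `|action_cost beta c p v mu x a - action_cost beta c p (vt t.+1) (mut t) x a|
    <= horizon_gap t.
Proof. by move=> tT; apply: action_cost_gap => // y; exact: value_gap. Qed.

Lemma policy_gap t x : (t < T)%N ->
  l1_dist (f x) (ft t x) <= horizon_gap t / rho.
Proof.
move=> tT.
apply: (minimizer_lipschitz rho_gt0 Omega_sc (f_min x) (ft_min x tT)) => a.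
exact: action_cost_horizon_gap.
Qed.

(** The recursion for the comparison principle: [next_state_law_dist] with policy span Lbar / rho
    and policy distance [horizon_gap t / rho], halved. The sum in the gap produces the feedback, its
    terminal part the forcing. *)
Lemma flow_gap t : (t.+1 < T)%N ->
  tv_dist mu (mut t.+1) <= Kbar beta L1 K1 rho * tv_dist mu (mut t)
    + feedback_gain beta L1 K1 rho
      * (\sum_(t <= j < T) beta ^+ (j - t) * tv_dist mu (mut j))
    + K1 * V / (2 * rho) * beta ^+ (T - t).
Proof.
move=> tT; set S := \sum_(t <= j < T) _.
have : l1_dist mu (mut t.+1)
    <= K1 * (3 + Lb / rho) * tv_dist mu (mut t) + K1 * (horizon_gap t / rho).
  rewrite /l1_dist; under eq_bigr do rewrite muE mutE//.
  apply: next_state_law_dist => //; first exact: ltW.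
    exact: policy_span.
  by move=> x; apply: policy_gap; exact: ltnW.
have gapE : 2^-1 * (K1 * (horizon_gap t / rho))
    = feedback_gain beta L1 K1 rho * S + K1 * V / (2 * rho) * beta ^+ (T - t).
  by rewrite /horizon_gap /feedback_gain -/Lb -/S; field; rewrite gt_eqF.
have := ler_wpM2r (tv_dist_ge0 mu (mut t))
  (one_step_coefficient_le beta_gt0 beta_lt1 L1_gt0 K1_gt0 rho_gt0 bK1).
rewrite -/Lb l1_distE; lra.
Qed.

End HorizonGap.

(** * Discounted sums cut at time s *)

Section DiscountedTail.
Context (R : realType) (beta : R).
Hypotheses (beta_gt0 : 0 < beta) (beta_lt1 : beta < 1).

(** From s on only e <= 1 is used, leaving a geometric tail. Before s, in the part with x, the
    discount is dropped and each of the s - t powers x^j is at most x^(s-1), as x >= 1. *)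
Lemma discounted_sum_le (r x D : R) (e : nat -> R) (t s T : nat) :
  0 <= r -> r < 1 -> 1 <= x -> 0 <= D -> (t < s < T)%N ->
  (forall j, e j <= 1) ->
  (forall j, (j < T)%N -> e j <= r ^+ j + D * (x ^+ j / x ^+ T)) ->
  \sum_(t <= j < T) beta ^+ (j - t) * e j
  <= r ^+ t / (1 - beta * r) + D * ((s - t)%:R * (x ^+ s / x ^+ T.+1))
     + beta ^+ (s - t) / (1 - beta).
Proof.
move=> r0 r1 x1 D0 /andP[ts sT] e1 eD.
have x0 : 0 < x := lt_le_trans ltr01 x1.
have pow0 n : 0 <= beta ^+ n by rewrite exprn_ge0// ltW.
rewrite (big_cat_nat (ltnW ts) (ltnW sT))/=; apply: lerD; last first.
  have := truncated_geometric_le (ltW beta_gt0) s T (@ler01 R).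
  rewrite mulr1 expr1n => /(_ beta_lt1) /(ler_wpM2l (pow0 (s - t)%N)).
  rewrite mul1r; apply: le_trans; rewrite mulr_sumr.
  apply: ler_sum_nat => j /andP[sj _]; rewrite expr1n mulr1 -exprD.
  by rewrite addnC addnBA ?(ltnW ts)// subnK// ler_piMr.
apply: (@le_trans _ _ (\sum_(t <= j < s) beta ^+ (j - t) * r ^+ j
                       + \sum_(t <= j < s) D * (x ^+ s / x ^+ T.+1))).
  rewrite -big_split; apply: ler_sum_nat => j /andP[tj js] /=.
  (* Shifting both exponents by one produces the T + 1 of the bound on the Q-functions. *)
  have xs : x ^+ s / x ^+ T.+1 = x ^+ s.-1 / x ^+ T.
    rewrite -{1}(prednK (leq_ltn_trans (leq0n _) js)) !exprS.
    by field; rewrite !gt_eqF// exprn_gt0.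
  have eb := ler_wpM2l (pow0 (j - t)%N) (eD j (ltn_trans js sT)).
  apply: le_trans eb _; rewrite mulrDr lerD2l xs.
  apply: (@le_trans _ _ (D * (x ^+ j / x ^+ T))).
    rewrite ler_piMl ?mulr_ge0 ?invr_ge0 ?exprn_ge0 ?(ltW x0)//.
    by rewrite exprn_ile1 ?(ltW beta_gt0) ?(ltW beta_lt1).
  rewrite ler_wpM2l// ler_wpM2r ?invr_ge0 ?exprn_ge0 ?(ltW x0)//.
  by apply: ler_weXn2l => //; rewrite -ltnS prednK// (leq_ltn_trans (leq0n _) js).
apply: lerD; last by rewrite sumr_const_nat -[leLHS]mulr_natl mulrCA.
apply: truncated_geometric_le => //; first exact: ltW.
by apply: le_lt_trans r1; rewrite ler_piMl// ltW.
Qed.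

(** Here h will be the horizon rate: x <= h handles the numerator, 1 / x <= beta^eps the
    denominator. *)
Lemma power_ratio_le (x h eps : R) (n m : nat) :
  0 < x -> x <= h -> x^-1 <= beta `^ eps ->
  x ^+ n / x ^+ m <= h ^+ n * beta `^ (m%:R * eps).
Proof.
move=> x0 xh xb; apply: ler_pM; rewrite ?invr_ge0 ?exprn_ge0 ?(ltW x0)//.
  by rewrite lerXn2r ?nnegrE ?(ltW x0) ?(le_trans (ltW x0) xh).
rewrite mulrC powRrM powR_mulrn ?powR_ge0// -exprVn.
by rewrite lerXn2r ?nnegrE ?invr_ge0 ?powR_ge0 ?(ltW x0).
Qed.

End DiscountedTail.

(** * Assembly of the two estimates *)

Theorem corollary4 (R : realType) (X : finType) (A : pointedFinType)
    (beta L1 K1 rho eps : R) (mu0 : fdist R X)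
    (c : X -> A -> fdist R X -> R) (p : X -> A -> fdist R X -> fdist R X)
    (Omega : fdist R A -> R)
    (hbeta : 0 < beta < 1) (hL1 : 0 < L1) (hK1 : 0 < K1) (hbK1 : beta * K1 < 2)
    (hc : lipschitz_cost c L1) (hp : lipschitz_transition p K1)
    (hrho : 0 < rho) (hOmega_cont : continuous Omega)
    (hOmega_convex : strongly_convex rho Omega)
    (heps : 0 < eps < 1)
    (h1 : Num.sqrt (Khat beta L1 K1 rho)
            / (Num.sqrt (Khat beta L1 K1 rho)
               + Num.sqrt (Khat beta L1 K1 rho - Kbar beta L1 K1 rho))
          > beta `^ (1 - eps))
    (h2 : Num.sqrt (Khat beta L1 K1 rho * beta)
            + Num.sqrt ((Khat beta L1 K1 rho - Kbar beta L1 K1 rho) * beta) < 1)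
    (h3 : contraction_rate beta L1 K1 rho < 1)
    (pi : X -> probability (borel_simplex R A) R)
    (mu : fdist R X) (Q : X -> fdist R A -> R)
    (hstat : stationary_mfe beta c p Omega pi mu Q)
    (piT : nat -> nat -> X -> probability (borel_simplex R A) R)
    (muT : nat -> nat -> fdist R X)
    (QT : nat -> nat -> X -> fdist R A -> R)
    (hfin : forall T : nat, (0 < T)%N ->
       finite_horizon_mfe beta c p Omega mu0 T (piT T) (muT T) (QT T)) :
  exists (M : R) (T0 : nat), forall T t s : nat,
    (T0 <= T)%N -> (t < s)%N -> (s < T)%N ->
    tv_dist mu (muT T t) <=
      M * (contraction_rate beta L1 K1 rho ^+ t
           + (T%:R - t%:R)^-1 * horizon_rate beta L1 K1 rho T ^+ t
             * (T%:R + 1) * beta `^ (T%:R * eps))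
    /\
    (sup_dist Q (QT T t) <=
      (M * ((s%:R - t%:R) / (T%:R + 1 - t%:R)
              * horizon_rate beta L1 K1 rho T ^+ s
              * (2 * T%:R + 1) * beta `^ ((T%:R + 1) * eps)
            + beta ^+ (s - t)%N
            + contraction_rate beta L1 K1 rho ^+ t))%:E)%E.
Proof.
have [beta_gt0 beta_lt1] := andP hbeta; have [eps_gt0 _] := andP heps.
have [f [v [Qq f_min vE muE]]] := stationary_mfe_values hstat.
pose V := \sum_x `|v x|.
have v_le x : `|v x| <= V by rewrite /V (bigD1 x)//= lerDl sumr_ge0.
have V_ge0 : 0 <= V by apply: sumr_ge0.
have Lb_gt0 : 0 < Lbar beta L1 K1 by exact: Lbar_gt0.
have k_gt0 : 0 < feedback_gain beta L1 K1 rho by exact: feedback_gain_gt0.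
have Kb_gt0 : 0 < Kbar beta L1 K1 rho by exact: Kbar_gt0.
set r := contraction_rate beta L1 K1 rho in h3 *.
have rE : r = feedback_gain beta L1 K1 rho / (1 - beta) + Kbar beta L1 K1 rho.
  exact: contraction_rateE.
have r_ge0 : 0 <= r.
  rewrite rE addr_ge0 ?(ltW Kb_gt0)// divr_ge0 ?(ltW k_gt0)//.
  by rewrite subr_ge0 ltW.
set x := critical_rate beta L1 K1 rho.
have x_gt0 : 0 < x by exact: critical_rate_gt0.
have betax_lt1 : beta * x < 1 by exact: beta_critical_rate_lt1.
have x_strict : 0 < x - (Kbar beta L1 K1 rho
    + feedback_gain beta L1 K1 rho / (1 - beta * x)).
  exact: critical_rate_strict.
have x_eps : x^-1 <= beta `^ eps by exact: critical_rate_ge.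
have x_ge1 : 1 <= x.
  rewrite -[x]invrK invf_ge1 ?invr_gt0//; apply: le_trans x_eps _.
  by rewrite -[leRHS](powRr0 beta) ger_powR ?beta_gt0 ?ltW.
pose C := K1 * V / (2 * rho).
have C_ge0 : 0 <= C.
  by rewrite /C divr_ge0 ?mulr_ge0 ?(ltW K1_gt0) ?(ltW hrho) ?(ltW hK1).
set delta := x - _ in x_strict.
pose D := C / delta.
have D_ge0 : 0 <= D by rewrite divr_ge0// ltW.
have br_lt1 : 0 < 1 - beta * r.
  by rewrite subr_gt0; apply: le_lt_trans h3; rewrite ler_piMl// ltW.
(* The coefficients in [gap_le]: 2 Lbar times those of [discounted_sum_le], with V added for the
   terminal term. None depends on T. *)
pose M1 := 2 * Lbar beta L1 K1 / (1 - beta * r).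
pose M2 := 2 * Lbar beta L1 K1 * D.
pose M3 := 2 * Lbar beta L1 K1 / (1 - beta) + V.
have Lb2_ge0 : 0 <= 2 * Lbar beta L1 K1 by rewrite mulr_ge0// ltW.
have M1_ge0 : 0 <= M1 := divr_ge0 Lb2_ge0 (ltW br_lt1).
have M2_ge0 : 0 <= M2 := mulr_ge0 Lb2_ge0 D_ge0.
have M3_ge0 : 0 <= M3.
  by apply: addr_ge0 => //; rewrite divr_ge0// subr_ge0 ltW.
(* The first estimate uses 1 + D, the second M1, M2 and M3. From T = 2 on, the horizon matrix is
   nonempty. *)
exists (1 + D + M1 + M2 + M3), 2%N => T t s T2 ts sT.
have tT := ltn_trans ts sT.
have [ft [vt [vtT Qtq ft_min vtE mutE]]] :=
  finite_horizon_mfe_values (hfin T (leq_trans (ltn0Sn 1) T2)).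
pose e j := tv_dist mu (muT T j).
have e_le j : (j < T)%N -> e j <= r ^+ j + D * (x ^+ j / x ^+ T).
  (* The initial error is a total variation distance, so the comparison runs with M = 1. *)
  move=> jT; rewrite -[r ^+ j]mul1r rE.
  apply: (@forward_backward_comparison _ beta (ltW beta_gt0)
    (feedback_gain beta L1 K1 rho) (Kbar beta L1 K1 rho) C x) => //.
  - exact: ltW.
  - exact: ltW.
  - by rewrite -rE.
  - exact: tv_dist_le1.
  - move=> i iT.
    exact: (flow_gap beta_gt0 beta_lt1 hL1 hK1 hrho hbK1 hc hp hOmega_convex
      f_min vE muE v_le vtT ft_min vtE mutE).
have x_le_h := critical_rate_le_horizon_rate beta_gt0 beta_lt1 hL1 hK1 hrho hbK1 T2.
rewrite -/x in x_le_h; set h := horizon_rate beta L1 K1 rho T in x_le_h *.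
have h_ge0 : 0 <= h := le_trans (ltW x_gt0) x_le_h.
have tTR : t%:R < T%:R :> R by rewrite ltr_nat.
have t_ge0 : 0 <= t%:R :> R by [].
have stE : (s - t)%:R = s%:R - t%:R :> R by rewrite natrB// ltnW.
have st_ge0 : 0 <= s%:R - t%:R :> R by rewrite -stE.
have rt_ge0 : 0 <= r ^+ t by rewrite exprn_ge0.
split.
  set B := (T%:R - t%:R)^-1 * _ * _ * _.
  (* The factor (T + 1) / (T - t) is at least 1, so inserting it only weakens the bound. *)
  have B_ge : x ^+ t / x ^+ T <= B.
    apply: le_trans (power_ratio_le t T x_gt0 x_le_h x_eps) _.
    have -> : B = (T%:R + 1) / (T%:R - t%:R) * (h ^+ t * beta `^ (T%:R * eps)).
      by rewrite /B; ring.
    rewrite ler_peMl ?mulr_ge0 ?exprn_ge0 ?powR_ge0//.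
    by rewrite ler_pdivlMr ?subr_gt0// mul1r; lra.
  have B_ge0 : 0 <= B by apply: le_trans B_ge; rewrite divr_ge0 ?exprn_ge0 ?(ltW x_gt0).
  apply: le_trans (e_le t tT) _.
  have DB := ler_wpM2l D_ge0 B_ge; clearbody B M1 M2 M3 D.
  apply: (@le_trans _ _ (1 * r ^+ t + D * B)); first by rewrite mul1r lerD2l.
  by rewrite mulrDr; apply: lerD; rewrite ler_wpM2r//; lra.
have gap_le : horizon_gap beta L1 K1 mu V T (muT T) t <= M1 * r ^+ t
    + M2 * ((s%:R - t%:R) * (x ^+ s / x ^+ T.+1)) + M3 * beta ^+ (s - t).
  have sum_le := discounted_sum_le beta_gt0 beta_lt1 r_ge0 h3 x_ge1 D_ge0
    (introT andP (conj ts sT)) (fun j => tv_dist_le1 mu (muT T j)) e_le.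
  (* The terminal term is absorbed into the tail after s. *)
  have pow_le : beta ^+ (T - t) <= beta ^+ (s - t).
    by apply: ler_wiXn2l; rewrite ?(ltW beta_gt0) ?(ltW beta_lt1)// leq_sub2r// ltnW.
  apply: le_trans (lerD (ler_wpM2l Lb2_ge0 sum_le) (ler_wpM2r V_ge0 pow_le)) _.
  by rewrite stE /M1 /M2 /M3 le_eqVlt; apply/orP; left; apply/eqP; ring.
set B := (s%:R - t%:R) / _ * _ * _ * _.
(* Here the inserted factor is (2T + 1) / (T + 1 - t), again at least 1. *)
have B_ge : (s%:R - t%:R) * (x ^+ s / x ^+ T.+1) <= B.
  have -> : B = (s%:R - t%:R) * ((2 * T%:R + 1) / (T%:R + 1 - t%:R)
      * (h ^+ s * beta `^ ((T%:R + 1) * eps))) by rewrite /B; ring.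
  rewrite ler_wpM2l//.
  apply: le_trans (power_ratio_le s T.+1 x_gt0 x_le_h x_eps) _.
  rewrite -natr1 ler_peMl ?mulr_ge0 ?exprn_ge0 ?powR_ge0//.
  by rewrite ler_pdivlMr; lra.
have B_ge0 : 0 <= B.
  by apply: le_trans B_ge; rewrite mulr_ge0// divr_ge0 ?exprn_ge0 ?(ltW x_gt0).
apply: ge_ereal_sup => _ [[y u] _ <-]; rewrite lee_fin /=.
rewrite Qq Qtq//.
apply: (@le_trans _ _ (horizon_gap beta L1 K1 mu V T (muT T) t)).
  apply: regularized_diff => a.
  exact: (action_cost_horizon_gap beta_gt0 hL1 hK1 hbK1 hc hp
    f_min vE v_le vtT ft_min vtE).
apply: le_trans gap_le _; have MB := ler_wpM2l M2_ge0 B_ge.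
have bst_ge0 : 0 <= beta ^+ (s - t) by rewrite exprn_ge0// ltW.
clearbody B M1 M2 M3 D.
apply: (@le_trans _ _ (M2 * B + M3 * beta ^+ (s - t) + M1 * r ^+ t)).
  by rewrite [leRHS]addrC addrA lerD2r lerD2l.
rewrite !mulrDr; apply: lerD; first apply: lerD; rewrite ler_wpM2r//; lra.
Qed.
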